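(* Let $a,b,b'\in\mathbb{C}$, $c,c'\in\mathbb{C}\setminus\mathbb{Z}_{\leqslant 0}$ and $a-b\notin\mathbb{Z}$. Let $N$ be any positive integer and fix $x\in\mathbb{C}\setminus\{0\}$. Then $$F_2\left[a,b,b';c,c';\frac{x}{y},y\right]=\mathfrak{f}_c(b,a)\left(-\frac{x}{y}\right)^{-a}\sum_{m=0}^{N-1}c_1(m)y^m+\mathfrak{f}_c(a,b)\left(-\frac{x}{y}\right)^{-b}\sum_{m=0}^{N-1}c_2(m)y^m+\mathcal{O}\left(|y|^{\Re(a)+N}+|y|^{\Re(b)+N}\right)$$ as $y\to0$ in $\left|\arg\left(-\frac{x}{y}\right)\right|<\pi$, where $$\mathfrak{f}_{\gamma}(a,b)=\frac{\Gamma(\gamma)\Gamma(a-b)}{\Gamma(a)\Gamma(\gamma-b)},$$ $$c_1(m)=\sum_{\substack{k,\ell\geqslant0\\k+\ell=m}}\frac{(-k)_{\ell}(b')_{\ell}(a)_k(1-c+a)_k}{(c')_{\ell}(1-b+a)_k\,\ell!\,k!}x^{-k},\qquad c_2(m)=\sum_{\substack{k,\ell\geqslant0\\k+\ell=m}}\frac{(b')_{\ell}(a-b-k)_{\ell}(b)_k(1-c+b)_k}{(c')_{\ell}(1-a+b)_k\,\ell!\,k!}x^{-k}.$$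
   Context: The Appell function $F_2$ is defined for $a,b,b'\in\mathbb{C}$, $c,c'\in\mathbb{C}\setminus\mathbb{Z}_{\leqslant 0}$, $|x|+|y|<1$ by $$F_2[a,b,b';c,c';x,y]=\sum_{m,n=0}^{\infty}\frac{(a)_{m+n}(b)_m(b')_n}{(c)_m(c')_n}\frac{x^m}{m!}\frac{y^n}{n!},$$ where $(a)_n=a(a+1)\cdots(a+n-1)$, $(a)_0=1$. For $|y|<1$, $|x|>|y|+1$, $|\arg(-x)|<\pi$ and $a-b\notin\mathbb{Z}$, $F_2$ denotes its analytic continuation, which is given by Jaeger's formula $$F_2[a,b,b';c,c';x,y]=\mathfrak{f}_c(b,a)(-x)^{-a}\sum_{n=0}^{\infty}{}_2F_1\left[\begin{matrix}-n,b'\\c'\end{matrix};y\right]\frac{(a)_n(1-c+a)_n}{(1-b+a)_n\,n!}x^{-n}+\mathfrak{f}_c(a,b)(-x)^{-b}\sum_{n=0}^{\infty}{}_2F_1\left[\begin{matrix}a-b-n,b'\\c'\end{matrix};y\right]\frac{(b)_n(1-c+b)_n}{(1-a+b)_n\,n!}x^{-n},$$ with $\mathfrak{f}_{\gamma}(a,b)=\frac{\Gamma(\gamma)\Gamma(a-b)}{\Gamma(a)\Gamma(\gamma-b)}$ and ${}_2F_1$ the Gauss hypergeometric function. $1/\Gamma$ denotes the entire reciprocal Gamma function (zero at nonpositive integers). Complex powers have their principal values. *)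

(* Defs.v *)
From Stdlib Require Import Reals Factorial.
From Coquelicot Require Import Coquelicot.

Open Scope C_scope.

Definition Cnat (n : nat) : C := RtoC (INR n).

(* Principal argument, with values in (-PI, PI] and equal to PI on the negative
   real axis; the value at 0 is irrelevant. *)
Definition Carg (z : C) : R :=
  if Rle_dec 0 (Im z) then acos (Re z / Cmod z) else (- acos (Re z / Cmod z))%R.

Definition Cexp (z : C) : C :=
  ((exp (Re z) * cos (Im z))%R, (exp (Re z) * sin (Im z))%R).

Definition Clog (z : C) : C := (ln (Cmod z), Carg z).

Definition Cpower (z w : C) : C := Cexp (w * Clog z).

(* Limits are taken on real and imaginary parts; as for [Lim_seq], the value
   is meaningful only for convergent sequences. *)
Definition CLim_seq (u : nat -> C) : C :=
  (real (Lim_seq (fun n => Re (u n))), real (Lim_seq (fun n => Im (u n)))).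

Definition CSeries (a : nat -> C) : C := CLim_seq (sum_n a).

(* The Pochhammer symbol a (a + 1) ... (a + n - 1). *)
Fixpoint poch (a : C) (n : nat) : C :=
  match n with
  | O => 1
  | S k => poch a k * (a + Cnat k)
  end.

Definition Cfact (n : nat) : C := Cnat (fact n).

(* The entire function 1 / Gamma, by Gauss's product
   lim z (z + 1) ... (z + n) / (n! n^z). *)
Definition rGamma (z : C) : C :=
  CLim_seq (fun n => poch z (S n) * Cpower (Cnat n) (- z) / Cfact n).

(* The value at the poles 0, -1, -2, ... is irrelevant. *)
Definition CGamma (z : C) : C := / rGamma z.

(* Gamma(g) Gamma(a - b) / (Gamma(a) Gamma(g - b)), with the denominator read
   through 1 / Gamma, so that it vanishes when a or g - b is a pole. *)
Definition frakf (g a b : C) : C :=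
  CGamma g * CGamma (a - b) * rGamma a * rGamma (g - b).

Definition hyp2F1 (a b c z : C) : C :=
  CSeries (fun n => poch a n * poch b n / (poch c n * Cfact n) * Cpow z n).

(* The double series converges absolutely for |x| + |y| < 1, so that it may be
   summed iteratively. *)
Definition F2_series (a b b' c c' x y : C) : C :=
  CSeries (fun m => CSeries (fun n =>
    poch a (m + n) * poch b m * poch b' n / (poch c m * poch c' n)
      * (Cpow x m / Cfact m) * (Cpow y n / Cfact n))).

Definition F2_jaeger (a b b' c c' x y : C) : C :=
  frakf c b a * Cpower (- x) (- a)
    * CSeries (fun n =>
        hyp2F1 (- Cnat n) b' c' y
          * (poch a n * poch (1 - c + a) n / (poch (1 - b + a) n * Cfact n))
          * Cpow (/ x) n)
  + frakf c a b * Cpower (- x) (- b)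
    * CSeries (fun n =>
        hyp2F1 (a - b - Cnat n) b' c' y
          * (poch b n * poch (1 - c + b) n / (poch (1 - a + b) n * Cfact n))
          * Cpow (/ x) n).

(* The Appell function F_2 on the disjoint regions |x| + |y| < 1, where it is
   the double series, and |y| < 1, |x| > |y| + 1, |arg (-x)| < PI, where it is
   the analytic continuation of that series, given for a - b not in Z by
   Jaeger's formula.  The value 0 elsewhere is arbitrary. *)
Definition appell_F2 (a b b' c c' x y : C) : C :=
  if Rlt_dec (Cmod x + Cmod y) 1 then F2_series a b b' c c' x y
  else if Rlt_dec (Cmod y) 1 then
    if Rlt_dec (Cmod y + 1) (Cmod x) then
      if Rlt_dec (Rabs (Carg (- x))) PI then F2_jaeger a b b' c c' x y
      else 0
    else 0
  else 0.

(* The sums over k + l = m are indexed by k = 0, ..., m, with l = m - k. *)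
Definition coef1 (a b b' c c' x : C) (m : nat) : C :=
  sum_n (fun k => let l := (m - k)%nat in
    poch (- Cnat k) l * poch b' l * poch a k * poch (1 - c + a) k
      / (poch c' l * poch (1 - b + a) k * Cfact l * Cfact k)
      * Cpow (/ x) k) m.

Definition coef2 (a b b' c c' x : C) (m : nat) : C :=
  sum_n (fun k => let l := (m - k)%nat in
    poch b' l * poch (a - b - Cnat k) l * poch b k * poch (1 - c + b) k
      / (poch c' l * poch (1 - a + b) k * Cfact l * Cfact k)
      * Cpow (/ x) k) m.

Definition is_bigO {T : Type} (F : (T -> Prop) -> Prop) (f : T -> C) (g : T -> R) : Prop :=
  exists K : R, F (fun t => (Cmod (f t) <= K * g t)%R).

(* Main.v *)
Require Import Defs.
From Stdlib Require Import Reals Lra Lia Factorial.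
From Coquelicot Require Import Coquelicot.
Open Scope C_scope.

(** Once [y] is small, [x / y] is large, so the Appell function is Jaeger's sum
of two terms, each a power of [- (x / y)] times a series in
[/ (x / y) = (/ x) * y] whose coefficients are themselves power series in [y].
Such a term is a double series in [y ^ (k + l)], where [k] comes from the outer
series and [l] from the inner one.  The coefficients of the theorem collect the
terms with [k + l = m], so the error is the part of the double series with
[k + l >= N].

That part is [O(|y| ^ N)] as soon as the double coefficients grow at most
geometrically in [k] and [l] ([double_series_tail]).  Two facts give this growth.
A quotient of Pochhammer symbols in the same index is a product of quotients
[(p + n) / (t + n)], which stay bounded because they tend to 1 and never have a
zero denominator ([poch_ratio_bound]); here [a - b] not being an integer
keeps [1 - b + a + n] and [1 - a + b + n] away from 0.  The Pochhammer symbol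
[poch (w k) l], whose base moves like [- k], is controlled by
[(E + k + l)! / (E + k)!], and dividing by [l!] leaves a binomial coefficient,
at most [2 ^ (E + k + l)] ([poch_fact_bound]).

Finally [|z ^ w|] differs from [|z| ^ Re w] only by [exp (- Im w * arg z)], which
is bounded ([Cmod_Cpower_le]), so that the power in front is
[O(|y| ^ Re a)], respectively [O(|y| ^ Re b)]. *)

(** * Finite sums *)

(** The sum of the first [n] terms.  Unlike [sum_n], it can be empty, which the
induction on tails and the triangular sums below rely on. *)
Fixpoint head_sum (u : nat -> C) (n : nat) : C :=
  match n with
  | O => 0
  | S m => head_sum u m + u m
  end.

Lemma sum_n_head_sum (u : nat -> C) (n : nat) : sum_n u n = head_sum u (S n).
Proof.
  induction n as [|n IH].
  - rewrite sum_O; simpl; ring.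
  - rewrite sum_Sn, IH; reflexivity.
Qed.

Lemma head_sum_ext (u v : nat -> C) (n : nat) :
  (forall k, (k < n)%nat -> u k = v k) -> head_sum u n = head_sum v n.
Proof.
  induction n as [|n IH]; intros H; simpl; [reflexivity|].
  rewrite IH, H; [reflexivity|lia|intros; apply H; lia].
Qed.

Lemma head_sum_plus (u v : nat -> C) (n : nat) :
  head_sum (fun k => u k + v k) n = head_sum u n + head_sum v n.
Proof. induction n as [|n IH]; simpl; [|rewrite IH]; ring. Qed.

Lemma head_sum_minus (u v : nat -> C) (n : nat) :
  head_sum (fun k => u k - v k) n = head_sum u n - head_sum v n.
Proof. induction n as [|n IH]; simpl; [|rewrite IH]; ring. Qed.

Lemma head_sum_scal (u : nat -> C) (z : C) (n : nat) :
  head_sum (fun k => u k * z) n = head_sum u n * z.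
Proof. induction n as [|n IH]; simpl; [|rewrite IH]; ring. Qed.

Lemma Cmod_head_sum_le (u : nat -> C) (B : R) (n : nat) :
  (forall k, (k < n)%nat -> (Cmod (u k) <= B)%R) ->
  (Cmod (head_sum u n) <= INR n * B)%R.
Proof.
  induction n as [|n IH]; intros H.
  - simpl; rewrite Cmod_0; lra.
  - rewrite S_INR; simpl head_sum.
    eapply Rle_trans; [apply Cmod_triangle|].
    assert (H1 := H n ltac:(lia)).
    assert (H2 : (Cmod (head_sum u n) <= INR n * B)%R)
      by (apply IH; intros; apply H; lia).
    lra.
Qed.

(** Summing a triangle by rows or by antidiagonals.  Adding one more row
extends every row by exactly its entry on the new antidiagonal. *)
Lemma head_sum_triangle (F : nat -> nat -> C) (n : nat) :
  head_sum (fun k => head_sum (F k) (n - k)) n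
  = head_sum (fun m => head_sum (fun k => F k (m - k)%nat) (S m)) n.
Proof.
  induction n as [|n IH]; [reflexivity|].
  change (head_sum (fun k => head_sum (F k) (S n - k)) n + head_sum (F n) (S n - n)
          = head_sum (fun m => head_sum (fun k => F k (m - k)%nat) (S m)) n
            + (head_sum (fun k => F k (n - k)%nat) n + F n (n - n)%nat)).
  rewrite <- IH.
  rewrite (head_sum_ext _ (fun k => head_sum (F k) (n - k) + F k (n - k)%nat)).
  - rewrite head_sum_plus.
    replace (S n - n)%nat with 1%nat by lia.
    replace (n - n)%nat with 0%nat by lia.
    simpl; ring.
  - intros k Hk; replace (S n - k)%nat with (S (n - k)) by lia; reflexivity.
Qed.

(** * Tails of geometrically bounded series *)

Lemma CSeries_ext (u v : nat -> C) : (forall n, u n = v n) -> CSeries u = CSeries v.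
Proof.
  intros H; unfold CSeries, CLim_seq; f_equal; f_equal;
  apply Lim_seq_ext; intros n; f_equal; apply sum_n_ext; exact H.
Qed.

Lemma Re_sum_n (u : nat -> C) (n : nat) : Re (sum_n u n) = sum_n (fun k => Re (u k)) n.
Proof.
  induction n as [|n IH]; [rewrite !sum_O; reflexivity|].
  rewrite !sum_Sn, <- IH; reflexivity.
Qed.

Lemma Im_sum_n (u : nat -> C) (n : nat) : Im (sum_n u n) = sum_n (fun k => Im (u k)) n.
Proof.
  induction n as [|n IH]; [rewrite !sum_O; reflexivity|].
  rewrite !sum_Sn, <- IH; reflexivity.
Qed.

(** Reduces complex series to real ones, for which convergence and
comparison results are available. *)
Lemma CSeries_parts (u : nat -> C) :
  CSeries u = (Series (fun n => Re (u n)), Series (fun n => Im (u n))).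
Proof.
  unfold CSeries, CLim_seq, Series; f_equal; f_equal; apply Lim_seq_ext; intros n;
  [apply Re_sum_n|apply Im_sum_n].
Qed.

Lemma ex_series_geom_scal (M q : R) : (0 <= q <= 1 / 2)%R -> ex_series (fun n => (M * q ^ n)%R).
Proof.
  intros Hq; apply (ex_series_scal_l (V := R_NormedModule) M (fun n => (q ^ n)%R)), ex_series_geom.
  rewrite Rabs_pos_eq; lra.
Qed.

(** The ratio is kept below 1/2 so that the geometric sum costs a factor 2
independent of [q]; constants then stay uniform in [y]. *)
Lemma Rabs_Series_le_geom (a : nat -> R) (M q : R) :
  (0 <= q <= 1 / 2)%R -> (forall n, Rabs (a n) <= M * q ^ n)%R ->
  ex_series a /\ (Rabs (Series a) <= 2 * M)%R.
Proof.
  intros Hq Ha.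
  assert (HM : (0 <= M)%R)
    by (specialize (Ha 0%nat); simpl in Ha; pose proof (Rabs_pos (a 0%nat)); lra).
  assert (Hg := ex_series_geom_scal M q Hq).
  split; [exact (ex_series_le (V := R_CompleteNormedModule) a _ Ha Hg)|].
  eapply Rle_trans; [apply Series_Rabs|].
  { apply (ex_series_le (V := R_CompleteNormedModule)) with (2 := Hg).
    intros n; change (norm (Rabs (a n))) with (Rabs (Rabs (a n))).
    rewrite Rabs_Rabsolu; apply Ha. }
  eapply Rle_trans; [apply Series_le with (2 := Hg)|].
  { intros n; split; [apply Rabs_pos|apply Ha]. }
  rewrite Series_scal_l, Series_geom by (rewrite Rabs_pos_eq; lra).
  rewrite (Rmult_comm 2); apply Rmult_le_compat_l; [exact HM|].
  rewrite <- (Rinv_inv 2); apply Rinv_le_contravar; lra.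
Qed.

(** Each of the real and imaginary parts is at most [2 * M], and the modulus is at
most [sqrt 2 <= 2] times the larger of the two. *)
Lemma CSeries_bound (u : nat -> C) (M q : R) :
  (0 <= q <= 1 / 2)%R -> (forall n, Cmod (u n) <= M * q ^ n)%R ->
  (Cmod (CSeries u) <= 4 * M)%R.
Proof.
  intros Hq Hu.
  destruct (Rabs_Series_le_geom (fun n => Re (u n)) M q Hq) as [_ H1].
  { intros n; eapply Rle_trans; [apply re_le_Cmod|apply Hu]. }
  destruct (Rabs_Series_le_geom (fun n => Im (u n)) M q Hq) as [_ H2].
  { intros n; eapply Rle_trans; [|apply Hu].
    eapply Rle_trans; [apply Rmax_r|apply Rmax_Cmod]. }
  rewrite CSeries_parts.
  eapply Rle_trans; [apply Cmod_2Rmax|]; simpl.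
  assert (H3 : (sqrt 2 <= 2)%R).
  { rewrite <- (sqrt_square 2) at 2 by lra; apply sqrt_le_1_alt; lra. }
  replace (4 * M)%R with (2 * (2 * M))%R by ring.
  apply Rmult_le_compat; [apply sqrt_pos| |exact H3|apply Rmax_lub; assumption].
  eapply Rle_trans; [apply Rabs_pos|apply Rmax_l].
Qed.

Lemma CSeries_incr_n (u : nat -> C) (M q : R) (N : nat) :
  (0 <= q <= 1 / 2)%R -> (forall n, Cmod (u n) <= M * q ^ n)%R ->
  CSeries u = head_sum u N + CSeries (fun k => u (N + k)%nat).
Proof.
  intros Hq; revert u M; induction N as [|N IH]; intros u M Hu.
  - simpl; rewrite Cplus_0_l; reflexivity.
  - rewrite (IH u M Hu); simpl head_sum; rewrite <- Cplus_assoc; f_equal.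
    assert (Hb : forall n, (Cmod (u (N + n)%nat) <= (M * q ^ N) * q ^ n)%R)
      by (intros n; rewrite Rmult_assoc, <- pow_add; apply Hu).
    rewrite !CSeries_parts.
    rewrite (Series_incr_1 (fun n => Re (u (N + n)%nat))).
    rewrite (Series_incr_1 (fun n => Im (u (N + n)%nat))).
    + replace (N + 0)%nat with N by lia.
      apply injective_projections; simpl; f_equal; apply Series_ext; intros k;
      do 2 f_equal; lia.
    + apply (Rabs_Series_le_geom _ _ q Hq (fun n =>
        Rle_trans _ _ _ (Rle_trans _ _ _ (Rmax_r _ _) (Rmax_Cmod _)) (Hb n))).
    + apply (Rabs_Series_le_geom _ _ q Hq (fun n => Rle_trans _ _ _ (re_le_Cmod _) (Hb n))).
Qed.

(** The tail from [N] on is a series of the same kind, with [M * q ^ N] in place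
of [M]. *)
Lemma CSeries_tail (u : nat -> C) (M q : R) (N : nat) :
  (0 <= q <= 1 / 2)%R -> (forall n, Cmod (u n) <= M * q ^ n)%R ->
  (Cmod (CSeries u - head_sum u N) <= 4 * (M * q ^ N))%R.
Proof.
  intros Hq Hu.
  rewrite (CSeries_incr_n u M q N Hq Hu).
  replace (head_sum u N + CSeries (fun k => u (N + k)%nat) - head_sum u N)
    with (CSeries (fun k => u (N + k)%nat)) by ring.
  apply CSeries_bound with q; [exact Hq|].
  intros n; rewrite Rmult_assoc, <- pow_add; apply Hu.
Qed.

(** The square of terms is never rearranged: rows [k >= N] form a tail of the
outer series, and each row [k < N] is cut after [N - k] terms.  What remains is
a finite triangle, which can be resummed along [k + l = m].  The outer tail
costs [16 * M] and each of the [N] row tails [4 * M], in units of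
[(rho * Cmod y) ^ N].

The bound of row [k] is an arbitrary [A k], matched against [v k], because the
rows of interest grow with [k]. *)
Lemma double_series_tail (h : nat -> nat -> C) (v : nat -> C) (A : nat -> R) (M rho : R)
  (y : C) (N : nat) :
  (0 <= rho)%R ->
  (forall k l, Cmod (h k l) <= A k * rho ^ l)%R ->
  (forall k, A k * Cmod (v k) <= M * rho ^ k)%R ->
  (rho * Cmod y <= 1 / 2)%R ->
  (Cmod (CSeries (fun k => CSeries (fun l => h k l * Cpow y l) * v k * Cpow y k)
         - head_sum (fun m => head_sum (fun k => h k (m - k)%nat * v k) (S m) * Cpow y m) N)%C
   <= (16 + 4 * INR N) * M * (rho * Cmod y) ^ N)%R.
Proof.
  intros HR Hh Hv Hy.
  set (q := (rho * Cmod y)%R) in *.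
  assert (Hq : (0 <= q <= 1 / 2)%R)
    by (split; [apply Rmult_le_pos; [exact HR|apply Cmod_ge_0]|exact Hy]).
  set (g := fun k => CSeries (fun l => h k l * Cpow y l)).
  assert (Hg : forall k L, (Cmod (g k - head_sum (fun l => h k l * Cpow y l) L)%C
                            <= 4 * (A k * q ^ L))%R).
  { intros k L; apply CSeries_tail; [exact Hq|].
    intros l; rewrite Cmod_mult, Cmod_pow; unfold q; rewrite Rpow_mult_distr, <- Rmult_assoc.
    apply Rmult_le_compat_r; [apply pow_le, Cmod_ge_0|apply Hh]. }
  (* The error of cutting row k after L terms, weighted as in the outer series;
     L = 0 gives the size of the whole row. *)
  assert (Hgv : forall k L,
    (Cmod ((g k - head_sum (fun l => h k l * Cpow y l) L) * v k * Cpow y k)%C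
       <= 4 * M * q ^ (k + L))%R).
  { intros k L; rewrite !Cmod_mult, Cmod_pow.
    apply Rle_trans with (4 * (A k * q ^ L) * Cmod (v k) * Cmod y ^ k)%R.
    - apply Rmult_le_compat_r; [apply pow_le, Cmod_ge_0|].
      apply Rmult_le_compat_r; [apply Cmod_ge_0|apply Hg].
    - replace (4 * (A k * q ^ L) * Cmod (v k) * Cmod y ^ k)%R
        with ((A k * Cmod (v k)) * (4 * q ^ L * Cmod y ^ k))%R by ring.
      rewrite pow_add.
      replace (4 * M * (q ^ k * q ^ L))%R with ((M * rho ^ k) * (4 * q ^ L * Cmod y ^ k))%R
        by (unfold q at 2; rewrite Rpow_mult_distr; ring).
      apply Rmult_le_compat_r; [|apply Hv].
      repeat apply Rmult_le_pos; try lra; apply pow_le; [apply Hq|apply Cmod_ge_0]. }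
  assert (HT : head_sum (fun m => head_sum (fun k => h k (m - k)%nat * v k) (S m) * Cpow y m) N
     = head_sum (fun k => head_sum (fun l => h k l * Cpow y l) (N - k) * v k * Cpow y k) N).
  { rewrite (head_sum_ext (fun k => head_sum (fun l => h k l * Cpow y l) (N - k) * v k * Cpow y k)
       (fun k => head_sum ((fun k l => h k l * Cpow y l * v k * Cpow y k) k) (N - k)))
      by (intros k _; rewrite !head_sum_scal; reflexivity).
    rewrite head_sum_triangle; apply head_sum_ext; intros m _.
    rewrite <- head_sum_scal; apply head_sum_ext; intros k Hk.
    replace (Cpow y m) with (Cpow y (m - k) * Cpow y k)
      by (rewrite <- Cpow_add_r; f_equal; lia).
    ring. }
  rewrite HT; fold g.
  set (G := fun k => g k * v k * Cpow y k).
  set (P := head_sum (fun k => head_sum (fun l => h k l * Cpow y l) (N - k) * v k * Cpow y k) N).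
  change (CSeries _) with (CSeries G).
  replace (CSeries G - P) with ((CSeries G - head_sum G N) + (head_sum G N - P)) by ring.
  eapply Rle_trans; [apply Cmod_triangle|].
  assert (H1 : (Cmod (CSeries G - head_sum G N) <= 4 * (4 * M * q ^ N))%R).
  { apply CSeries_tail; [exact Hq|]; intros k.
    specialize (Hgv k 0%nat); rewrite Nat.add_0_r in Hgv.
    replace (G k) with ((g k - head_sum (fun l => h k l * Cpow y l) 0) * v k * Cpow y k)
      by (unfold G; simpl; ring).
    exact Hgv. }
  assert (H2 : (Cmod (head_sum G N - P) <= INR N * (4 * M * q ^ N))%R).
  { unfold P; rewrite <- head_sum_minus; apply Cmod_head_sum_le; intros k Hk.
    specialize (Hgv k (N - k)%nat); replace (k + (N - k))%nat with N in Hgv by lia.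
    replace (G k - head_sum (fun l => h k l * Cpow y l) (N - k) * v k * Cpow y k)
      with ((g k - head_sum (fun l => h k l * Cpow y l) (N - k)) * v k * Cpow y k)
      by (unfold G; ring).
    exact Hgv. }
  replace ((16 + 4 * INR N) * M * q ^ N)%R
    with (4 * (4 * M * q ^ N) + INR N * (4 * M * q ^ N))%R by ring.
  apply Rplus_le_compat; [exact H1|exact H2].
Qed.
(** * Growth of Pochhammer symbols *)

Lemma Cmod_Cnat (n : nat) : Cmod (Cnat n) = INR n.
Proof. unfold Cnat; rewrite Cmod_R, Rabs_pos_eq; [reflexivity|apply pos_INR]. Qed.

Lemma Cnat_S (n : nat) : Cnat (S n) = Cnat n + 1.
Proof. unfold Cnat; rewrite S_INR, RtoC_plus; reflexivity. Qed.

Lemma Cfact_neq_0 (n : nat) : Cfact n <> 0.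
Proof. intros H; apply RtoC_inj in H; exact (INR_fact_neq_0 n H). Qed.

Lemma Cfact_poch (n : nat) : Cfact n = poch 1 n.
Proof.
  induction n as [|n IH]; [reflexivity|]; simpl poch; rewrite <- IH.
  unfold Cfact, Cnat; rewrite fact_simpl, mult_INR, S_INR, RtoC_mult, RtoC_plus; ring.
Qed.

Lemma one_plus_Cnat_neq_0 (n : nat) : 1 + Cnat n <> 0.
Proof.
  rewrite Cplus_comm, <- Cnat_S; intros H; apply RtoC_inj in H.
  exact (not_0_INR (S n) ltac:(lia) H).
Qed.

Lemma poch_neq_0 (t : C) (n : nat) : (forall m, t + Cnat m <> 0) -> poch t n <> 0.
Proof.
  intros Ht; induction n as [|n IH]; simpl; [|apply Cmult_neq_0; auto].
  intros H; apply RtoC_inj in H; lra.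
Qed.

(** For [n > |p| + 2 * |t|] the numerator is at most [2 * n] and the denominator
at least [n / 2], so 4 works; the finitely many smaller [n] are absorbed by a
maximum, since no denominator vanishes. *)
Lemma shift_ratio_bound (p t : C) :
  (forall n, t + Cnat n <> 0) ->
  exists rho : R, (0 <= rho)%R /\ forall n, (Cmod (p + Cnat n) <= rho * Cmod (t + Cnat n))%R.
Proof.
  intros Ht.
  assert (Hfin : forall m, exists rho : R, (4 <= rho)%R /\
    forall n, (n < m)%nat -> (Cmod (p + Cnat n) <= rho * Cmod (t + Cnat n))%R).
  { induction m as [|m [rho [HR IH]]]; [exists 4%R; split; [lra|intros; lia]|].
    assert (Hm := proj1 (Cmod_gt_0 _) (Ht m)).
    set (r := (Cmod (p + Cnat m) / Cmod (t + Cnat m))%R).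
    exists (Rmax rho r); split; [eapply Rle_trans; [exact HR|apply Rmax_l]|].
    intros n Hn; destruct (Nat.eq_dec n m) as [->|Hne].
    - apply Rle_trans with (r * Cmod (t + Cnat m))%R.
      + unfold r; right; field; lra.
      + apply Rmult_le_compat_r; [lra|apply Rmax_r].
    - eapply Rle_trans; [apply IH; lia|].
      apply Rmult_le_compat_r; [apply Cmod_ge_0|apply Rmax_l]. }
  destruct (nfloor_ex (Cmod p + 2 * Cmod t)%R) as [n0 [_ Hn0]].
  { pose proof (Cmod_ge_0 p); pose proof (Cmod_ge_0 t); lra. }
  destruct (Hfin (S n0)) as [rho [HR HRn]].
  exists rho; split; [lra|]; intros n.
  destruct (Nat.lt_ge_cases n (S n0)) as [Hlt|Hge]; [apply HRn, Hlt|].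
  apply le_INR in Hge; rewrite S_INR in Hge.
  pose proof (Cmod_ge_0 p); pose proof (Cmod_ge_0 t).
  assert (H1 : (Cmod (p + Cnat n) <= Cmod p + INR n)%R)
    by (rewrite <- Cmod_Cnat; apply Cmod_triangle).
  assert (H2 : (INR n <= Cmod (t + Cnat n) + Cmod t)%R).
  { rewrite <- Cmod_Cnat, <- (Cmod_opp t).
    replace (Cnat n) with ((t + Cnat n) + - t) at 1 by ring; apply Cmod_triangle. }
  apply Rle_trans with (4 * Cmod (t + Cnat n))%R; [lra|].
  apply Rmult_le_compat_r; [apply Cmod_ge_0|exact HR].
Qed.

Lemma poch_ratio_bound (p t : C) :
  (forall n, t + Cnat n <> 0) ->
  exists rho : R, (0 <= rho)%R /\ forall n, (Cmod (poch p n / poch t n) <= rho ^ n)%R.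
Proof.
  intros Ht; destruct (shift_ratio_bound p t Ht) as [rho [HR HRn]].
  exists rho; split; [exact HR|].
  induction n as [|n IH]; simpl.
  - replace (1 / 1) with (RtoC 1) by (field; intros H; apply RtoC_inj in H; lra).
    rewrite Cmod_1; lra.
  - replace (poch p n * (p + Cnat n) / (poch t n * (t + Cnat n)))
      with ((p + Cnat n) / (t + Cnat n) * (poch p n / poch t n))
      by (field; split; [|apply poch_neq_0]; auto).
    rewrite Cmod_mult; apply Rmult_le_compat; try apply Cmod_ge_0; [|exact IH].
    rewrite Cmod_div by auto.
    assert (Hm := proj1 (Cmod_gt_0 _) (Ht n)).
    apply Rmult_le_reg_r with (Cmod (t + Cnat n)); [exact Hm|].
    unfold Rdiv; rewrite Rmult_assoc, Rinv_l, Rmult_1_r by lra; apply HRn.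
Qed.

(** The binomial coefficient of [m + n] over [m] is at most [2 ^ (m + n)], by
Pascal's rule. *)
Lemma fact_add_le (m n : nat) : (fact (m + n) <= 2 ^ (m + n) * (fact m * fact n))%nat.
Proof.
  revert n; induction m as [|m IHm]; intros n.
  - simpl; pose proof (Nat.pow_nonzero 2 n); nia.
  - induction n as [|n IHn].
    + rewrite Nat.add_0_r; simpl fact at 3; pose proof (Nat.pow_nonzero 2 (S m)); nia.
    + specialize (IHm (S n)).
      replace (S m + n)%nat with (m + S n)%nat in IHn by lia.
      replace (S m + S n)%nat with (S (m + S n)) by lia.
      change (fact (S (m + S n))) with (S (m + S n) * fact (m + S n))%nat.
      change (2 ^ S (m + S n))%nat with (2 * 2 ^ (m + S n))%nat.
      set (p := (2 ^ (m + S n))%nat) in *.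
      change (fact (S m)) with (S m * fact m)%nat in *.
      change (fact (S n)) with (S n * fact n)%nat in *.
      set (f := fact (m + S n)) in *.
      replace (S (m + S n) * f)%nat with (S m * f + S n * f)%nat by nia.
      assert (S m * f <= S m * (p * (fact m * (S n * fact n))))%nat by (apply Nat.mul_le_mono_l; lia).
      assert (S n * f <= S n * (p * (S m * fact m * fact n)))%nat by (apply Nat.mul_le_mono_l; lia).
      nia.
Qed.

(** The bound is explicit in [E] so that it can be used with a base [z] that
grows linearly with the outer index. *)
Lemma poch_fact_bound (z : C) (E n : nat) :
  (Cmod z <= INR E)%R -> (Cmod (poch z n / Cfact n) <= 2 ^ E * 2 ^ n)%R.
Proof.
  intros Hz.
  (* Each factor satisfies |z + j| <= E + j + 1. *)
  assert (H : (Cmod (poch z n) * INR (fact E) <= INR (fact (E + n)))%R).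
  { induction n as [|n IH]; simpl poch.
    - rewrite Cmod_1, Nat.add_0_r; lra.
    - rewrite Cmod_mult, Nat.add_succ_r, fact_simpl, mult_INR.
      replace (Cmod (poch z n) * Cmod (z + Cnat n) * INR (fact E))%R
        with (Cmod (z + Cnat n) * (Cmod (poch z n) * INR (fact E)))%R by ring.
      apply Rmult_le_compat; [apply Cmod_ge_0| | |exact IH].
      + apply Rmult_le_pos; [apply Cmod_ge_0|apply pos_INR].
      + eapply Rle_trans; [apply Cmod_triangle|].
        rewrite Cmod_Cnat, S_INR, plus_INR; lra. }
  assert (H' : (INR (fact (E + n)) <= 2 ^ E * 2 ^ n * (INR (fact E) * INR (fact n)))%R).
  { rewrite <- pow_add, <- !mult_INR; change 2%R with (INR 2).
    rewrite <- pow_INR, <- mult_INR; apply le_INR, fact_add_le. }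
  rewrite Cmod_div by apply Cfact_neq_0.
  unfold Cfact; rewrite Cmod_Cnat.
  assert (HE := INR_fact_lt_0 E); assert (Hn := INR_fact_lt_0 n).
  apply Rmult_le_reg_r with (INR (fact E) * INR (fact n))%R; [apply Rmult_lt_0_compat; lra|].
  replace (Cmod (poch z n) / INR (fact n) * (INR (fact E) * INR (fact n)))%R
    with (Cmod (poch z n) * INR (fact E))%R by (field; lra).
  lra.
Qed.

(** * Modulus of complex powers *)

Lemma Cmod_Cexp (z : C) : Cmod (Cexp z) = exp (Re z).
Proof.
  unfold Cexp, Cmod; simpl.
  transitivity (sqrt (Rsqr (exp (Re z)) * (Rsqr (sin (Im z)) + Rsqr (cos (Im z))))).
  { f_equal; unfold Rsqr; ring. }
  rewrite sin2_cos2, Rmult_1_r.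
  apply sqrt_Rsqr, Rlt_le, exp_pos.
Qed.

Lemma Rabs_Carg_le (z : C) : (Rabs (Carg z) <= PI)%R.
Proof.
  unfold Carg; destruct (Rle_dec 0 (Im z)); rewrite ?Rabs_Ropp;
  rewrite Rabs_pos_eq; apply acos_bound.
Qed.

(** [|z ^ w| = |z| ^ Re w * exp (- Im w * arg z)], and the principal argument is
at most [PI] in absolute value. *)
Lemma Cmod_Cpower_le (z w : C) :
  (Cmod (Cpower z w) <= exp (Rabs (Im w) * PI) * Rpower (Cmod z) (Re w))%R.
Proof.
  unfold Cpower, Rpower; rewrite Cmod_Cexp, <- exp_plus.
  assert (H : (Re (w * Clog z) <= Rabs (Im w) * PI + Re w * ln (Cmod z))%R).
  { change (Re (w * Clog z)) with (Re w * ln (Cmod z) - Im w * Carg z)%R.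
    assert (H1 : (- (Im w * Carg z) <= Rabs (Im w * Carg z))%R)
      by (rewrite <- Rabs_Ropp; apply Rle_abs).
    rewrite Rabs_mult in H1.
    assert (H2 := Rmult_le_compat_l _ _ _ (Rabs_pos (Im w)) (Rabs_Carg_le z)).
    lra. }
  destruct H as [H|H]; [left; apply exp_increasing, H|right; rewrite H; reflexivity].
Qed.

(** * Jaeger's formula for small y *)

(** Covers both series of Jaeger's formula: [w k] is [- k] in the first one and
[a - b - k] in the second.  The hypothesis on [w] is all that the growth bound
needs to know about it. *)
Lemma jaeger_sum_expansion (w : nat -> C) (E : nat) (p s t b' c' x : C) (N : nat) :
  (forall k, Cmod (w k) <= INR (E + k))%R ->
  (forall n, c' + Cnat n <> 0) ->
  (forall n, t + Cnat n <> 0) ->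
  x <> 0 ->
  exists d K : R, (0 < d)%R /\ (0 <= K)%R /\ forall y : C, y <> 0 -> (Cmod y <= d)%R ->
    (Cmod (CSeries (fun n =>
             hyp2F1 (w n) b' c' y
               * (poch p n * poch s n / (poch t n * Cfact n))
               * Cpow (/ (x / y)) n)
           - head_sum (fun m =>
               head_sum (fun k =>
                 poch (w k) (m - k) * poch b' (m - k) * poch p k * poch s k
                   / (poch c' (m - k) * poch t k * Cfact (m - k) * Cfact k)
                   * Cpow (/ x) k) (S m) * Cpow y m) N)%C
     <= K * Cmod y ^ N)%R.
Proof.
  intros Hw Hc Ht Hx.
  destruct (poch_ratio_bound b' c' Hc) as [R1 [HR1 H1]].
  destruct (poch_ratio_bound p t Ht) as [R2 [HR2 H2]].
  destruct (poch_ratio_bound s 1 one_plus_Cnat_neq_0) as [R3 [HR3 H3]].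
  set (h := fun k l => poch (w k) l * poch b' l / (poch c' l * Cfact l)).
  set (v := fun k => poch p k * poch s k / (poch t k * Cfact k) * Cpow (/ x) k).
  set (r := Cmod (/ x)).
  assert (Hr : (0 <= r)%R) by apply Cmod_ge_0.
  assert (HQ : (0 <= R2 * R3 * r)%R) by (repeat apply Rmult_le_pos; assumption).
  (* The inner ratio is 2 * R1 and the outer one 2 * (R2 * R3 * r), both factors 2
     coming from the moving Pochhammer symbol; the sum dominates each of them. *)
  set (rho := (2 * R1 + 2 * (R2 * R3 * r) + 1)%R).
  assert (HR : (1 <= rho)%R) by (unfold rho; lra).
  assert (Hh : forall k l, (Cmod (h k l) <= 2 ^ E * 2 ^ k * rho ^ l)%R).
  { intros k l.
    replace (h k l) with ((poch (w k) l / Cfact l) * (poch b' l / poch c' l))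
      by (unfold h; field; split; [apply Cfact_neq_0|apply poch_neq_0, Hc]).
    rewrite Cmod_mult, <- pow_add.
    apply Rle_trans with (2 ^ (E + k) * 2 ^ l * R1 ^ l)%R.
    - apply Rmult_le_compat; try apply Cmod_ge_0; [apply poch_fact_bound, Hw|apply H1].
    - rewrite Rmult_assoc, <- Rpow_mult_distr.
      apply Rmult_le_compat_l; [apply pow_le; lra|].
      apply pow_incr; unfold rho; lra. }
  assert (Hv : forall k, (2 ^ E * 2 ^ k * Cmod (v k) <= 2 ^ E * rho ^ k)%R).
  { intros k; rewrite Rmult_assoc.
    apply Rmult_le_compat_l; [apply pow_le; lra|].
    replace (v k) with ((poch p k / poch t k) * (poch s k / poch 1 k) * Cpow (/ x) k)
      by (unfold v; rewrite Cfact_poch; field;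
          split; apply poch_neq_0; [apply one_plus_Cnat_neq_0|exact Ht]).
    rewrite !Cmod_mult, Cmod_pow.
    apply Rle_trans with (2 ^ k * (R2 ^ k * R3 ^ k * r ^ k))%R.
    - apply Rmult_le_compat_l; [apply pow_le; lra|].
      apply Rmult_le_compat_r; [apply pow_le, Hr|].
      apply Rmult_le_compat; try apply Cmod_ge_0; [apply H2|apply H3].
    - rewrite <- !Rpow_mult_distr; apply pow_incr; unfold rho; lra. }
  exists (/ (2 * rho))%R, ((16 + 4 * INR N) * 2 ^ E * rho ^ N)%R.
  split; [apply Rinv_0_lt_compat; lra|split].
  { assert (HN := pos_INR N); repeat apply Rmult_le_pos; try (apply pow_le); lra. }
  intros y Hy Hyd.
  assert (HRy : (rho * Cmod y <= 1 / 2)%R).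
  { apply Rle_trans with (rho * / (2 * rho))%R; [apply Rmult_le_compat_l; lra|].
    right; field; lra. }
  assert (Hmain := double_series_tail h v _ _ rho y N ltac:(lra) Hh Hv HRy).
  rewrite Rpow_mult_distr, <- Rmult_assoc in Hmain.
  eapply Rle_trans; [right|exact Hmain]; f_equal; apply (f_equal2 Cminus).
  - apply CSeries_ext; intros k; unfold v.
    replace (/ (x / y)) with (/ x * y) by (field; split; assumption).
    rewrite Cpow_mult_l; unfold hyp2F1, h; ring.
  - apply head_sum_ext; intros m _; apply (f_equal2 Cmult); [|reflexivity].
    apply head_sum_ext; intros k _.
    unfold h, v; field; repeat split; try apply Cfact_neq_0; apply poch_neq_0; assumption.
Qed.

Lemma jaeger_power_bound (x e : C) :
  x <> 0 ->
  exists K : R, (0 <= K)%R /\ forall y : C, y <> 0 ->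
    (Cmod (Cpower (- (x / y)) (- e)) <= K * Rpower (Cmod y) (Re e))%R.
Proof.
  intros Hx; assert (Hxm := proj1 (Cmod_gt_0 _) Hx).
  exists (exp (Rabs (Im (- e)) * PI) * Rpower (Cmod x) (- Re e))%R; split.
  { apply Rmult_le_pos; apply Rlt_le, exp_pos. }
  intros y Hy; assert (Hym := proj1 (Cmod_gt_0 _) Hy).
  eapply Rle_trans; [apply Cmod_Cpower_le|right].
  rewrite Rmult_assoc; f_equal.
  rewrite Cmod_opp, Cmod_div by exact Hy.
  change (Re (- e)) with (- Re e)%R.
  unfold Rpower; rewrite <- exp_plus; f_equal.
  rewrite ln_div by assumption; ring.
Qed.

Lemma appell_F2_jaeger (a b b' c c' x y : C) :
  (Cmod y < 1)%R -> (Cmod y + 1 < Cmod x)%R -> (Rabs (Carg (- x)) < PI)%R ->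
  appell_F2 a b b' c c' x y = F2_jaeger a b b' c c' x y.
Proof.
  intros Hy Hx Harg; unfold appell_F2; pose proof (Cmod_ge_0 y).
  destruct (Rlt_dec (Cmod x + Cmod y) 1); [lra|].
  destruct (Rlt_dec (Cmod y) 1); [|lra].
  destruct (Rlt_dec (Cmod y + 1) (Cmod x)); [|lra].
  destruct (Rlt_dec (Rabs (Carg (- x))) PI); [reflexivity|lra].
Qed.

Theorem corollary5p2 (a b b' c c' : C)
  (hc : forall n : nat, c <> - Cnat n)
  (hc' : forall n : nat, c' <> - Cnat n)
  (hab : forall k : Z, a - b <> RtoC (IZR k))
  (N : nat) (hN : (0 < N)%nat)
  (x : C) (hx : x <> 0) :
  is_bigO
    (within (fun y : C => (Rabs (Carg (- (x / y))) < PI)%R) (locally' (RtoC 0)))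
    (fun y : C =>
       appell_F2 a b b' c c' (x / y) y
       - (frakf c b a * Cpower (- (x / y)) (- a)
            * sum_n (fun m => coef1 a b b' c c' x m * Cpow y m) (N - 1)
          + frakf c a b * Cpower (- (x / y)) (- b)
            * sum_n (fun m => coef2 a b b' c c' x m * Cpow y m) (N - 1)))
    (fun y : C =>
       (Rpower (Cmod y) (Re a + INR N) + Rpower (Cmod y) (Re b + INR N))%R).
Proof.
  assert (Hc' : forall n, c' + Cnat n <> 0).
  { intros n H; apply (hc' n); replace c' with ((c' + Cnat n) - Cnat n) by ring.
    rewrite H; ring. }
  assert (Ht1 : forall n, 1 - b + a + Cnat n <> 0).
  { intros n H; apply (hab (- Z.of_nat (S n))%Z).
    rewrite opp_IZR, <- INR_IZR_INZ, RtoC_opp; change (RtoC (INR (S n))) with (Cnat (S n)).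
    rewrite Cnat_S; replace (a - b) with ((1 - b + a + Cnat n) - (Cnat n + 1)) by ring.
    rewrite H; ring. }
  assert (Ht2 : forall n, 1 - a + b + Cnat n <> 0).
  { intros n H; apply (hab (Z.of_nat (S n))).
    rewrite <- INR_IZR_INZ; change (RtoC (INR (S n))) with (Cnat (S n)).
    rewrite Cnat_S; replace (a - b) with ((Cnat n + 1) - (1 - a + b + Cnat n)) by ring.
    rewrite H; ring. }
  assert (Hw1 : forall k, (Cmod (- Cnat k) <= INR (0 + k))%R)
    by (intros k; rewrite Cmod_opp, Cmod_Cnat; apply Rle_refl).
  destruct (nfloor_ex (Cmod (a - b)) (Cmod_ge_0 _)) as [E [_ HE]].
  assert (Hw2 : forall k, (Cmod (a - b - Cnat k) <= INR (S E + k))%R).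
  { intros k; eapply Rle_trans; [apply Cmod_triangle|].
    rewrite Cmod_opp, Cmod_Cnat, plus_INR, S_INR; lra. }
  destruct (jaeger_sum_expansion _ _ a (1 - c + a) _ b' c' x N Hw1 Hc' Ht1 hx)
    as [d1 [K1 [Hd1 [HK1 H1]]]].
  destruct (jaeger_sum_expansion _ _ b (1 - c + b) _ b' c' x N Hw2 Hc' Ht2 hx)
    as [d2 [K2 [Hd2 [HK2 H2]]]].
  destruct (jaeger_power_bound x a hx) as [L1 [HL1 HP1]].
  destruct (jaeger_power_bound x b hx) as [L2 [HL2 HP2]].
  assert (Hxm := proj1 (Cmod_gt_0 _) hx).
  set (M1 := (Cmod (frakf c b a) * L1 * K1)%R).
  set (M2 := (Cmod (frakf c a b) * L2 * K2)%R).
  assert (HM1 : (0 <= M1)%R) by (repeat apply Rmult_le_pos; auto using Cmod_ge_0).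
  assert (HM2 : (0 <= M2)%R) by (repeat apply Rmult_le_pos; auto using Cmod_ge_0).
  exists (M1 + M2)%R; unfold within, locally'.
  (* Below |x| / 2 the quotient x / y has modulus at least 2, and below 1 / 2 this
     exceeds |y| + 1: y is then in the region of Jaeger's formula. *)
  set (d := Rmin (Rmin d1 d2) (Rmin (1 / 2) (Cmod x / 2))).
  assert (Hd : (0 < d)%R) by (repeat apply Rmin_glb_lt; lra).
  assert (Hd2' : (0 < d / 2)%R) by lra.
  (* Balls are taken componentwise, so half the radius bounds the modulus. *)
  exists (mkposreal _ Hd2'); intros y Hball Hy0 Harg.
  assert (Hyd : (Cmod y < d)%R).
  { destruct Hball as [Hb1 Hb2]; simpl in Hb1, Hb2.
    change (Rabs (fst y - 0) < d / 2)%R in Hb1; change (Rabs (snd y - 0) < d / 2)%R in Hb2.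
    rewrite Rminus_0_r in Hb1, Hb2.
    eapply Rle_lt_trans; [apply Cmod_2Rmax|].
    apply Rle_lt_trans with (2 * Rmax (Rabs (fst y)) (Rabs (snd y)))%R.
    - apply Rmult_le_compat_r; [eapply Rle_trans; [apply Rabs_pos|apply Rmax_l]|].
      rewrite <- (sqrt_square 2) at 2 by lra; apply sqrt_le_1_alt; lra.
    - apply (Rmax_lub_lt _ _ _ Hb1) in Hb2; lra. }
  assert (Hdl : (d <= d1 /\ d <= d2 /\ d <= 1 / 2 /\ d <= Cmod x / 2)%R).
  { unfold d; repeat split; unfold Rmin; repeat destruct Rle_dec; lra. }
  assert (Hym := proj1 (Cmod_gt_0 _) Hy0).
  specialize (H1 y Hy0 ltac:(lra)); specialize (H2 y Hy0 ltac:(lra)).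
  specialize (HP1 y Hy0); specialize (HP2 y Hy0).
  rewrite appell_F2_jaeger; [|lra| |exact Harg].
  2:{ rewrite Cmod_div by exact Hy0.
      apply Rlt_le_trans with 2%R; [lra|].
      apply Rmult_le_reg_r with (Cmod y); [exact Hym|].
      unfold Rdiv; rewrite Rmult_assoc, Rinv_l by lra; lra. }
  assert (Hc1 : sum_n (fun m => coef1 a b b' c c' x m * Cpow y m) (N - 1)
    = head_sum (fun m => head_sum (fun k =>
        poch (- Cnat k) (m - k) * poch b' (m - k) * poch a k * poch (1 - c + a) k
          / (poch c' (m - k) * poch (1 - b + a) k * Cfact (m - k) * Cfact k)
          * Cpow (/ x) k) (S m) * Cpow y m) N).
  { rewrite sum_n_head_sum; replace (S (N - 1)) with N by lia.
    apply head_sum_ext; intros m _; unfold coef1; rewrite sum_n_head_sum; reflexivity. }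
  assert (Hc2 : sum_n (fun m => coef2 a b b' c c' x m * Cpow y m) (N - 1)
    = head_sum (fun m => head_sum (fun k =>
        poch (a - b - Cnat k) (m - k) * poch b' (m - k) * poch b k * poch (1 - c + b) k
          / (poch c' (m - k) * poch (1 - a + b) k * Cfact (m - k) * Cfact k)
          * Cpow (/ x) k) (S m) * Cpow y m) N).
  { rewrite sum_n_head_sum; replace (S (N - 1)) with N by lia.
    apply head_sum_ext; intros m _; unfold coef2; rewrite sum_n_head_sum.
    apply (f_equal2 Cmult); [|reflexivity].
    apply head_sum_ext; intros k _; cbv zeta.
    rewrite (Cmult_comm (poch b' (m - k))); reflexivity. }
  rewrite Hc1, Hc2; unfold F2_jaeger.
  match type of H1 with (Cmod (?S - ?T) <= _)%R => set (S1 := S) in *; set (T1 := T) in * end.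
  match type of H2 with (Cmod (?S - ?T) <= _)%R => set (S2 := S) in *; set (T2 := T) in * end.
  set (P1 := Cpower (- (x / y)) (- a)) in *.
  set (P2 := Cpower (- (x / y)) (- b)) in *.
  replace (frakf c b a * P1 * S1 + frakf c a b * P2 * S2
           - (frakf c b a * P1 * T1 + frakf c a b * P2 * T2))
    with (frakf c b a * P1 * (S1 - T1) + frakf c a b * P2 * (S2 - T2)) by ring.
  rewrite !Rpower_plus, !Rpower_pow by exact Hym.
  set (Q1 := Rpower (Cmod y) (Re a)) in *; set (Q2 := Rpower (Cmod y) (Re b)) in *.
  assert (HB1 : (Cmod (frakf c b a * P1 * (S1 - T1)) <= M1 * (Q1 * Cmod y ^ N))%R).
  { rewrite !Cmod_mult.
    replace (M1 * (Q1 * Cmod y ^ N))%R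
      with (Cmod (frakf c b a) * (L1 * Q1) * (K1 * Cmod y ^ N))%R by (unfold M1; ring).
    apply Rmult_le_compat; try apply Cmod_ge_0; [apply Rmult_le_pos; apply Cmod_ge_0| |exact H1].
    apply Rmult_le_compat_l; [apply Cmod_ge_0|exact HP1]. }
  assert (HB2 : (Cmod (frakf c a b * P2 * (S2 - T2)) <= M2 * (Q2 * Cmod y ^ N))%R).
  { rewrite !Cmod_mult.
    replace (M2 * (Q2 * Cmod y ^ N))%R
      with (Cmod (frakf c a b) * (L2 * Q2) * (K2 * Cmod y ^ N))%R by (unfold M2; ring).
    apply Rmult_le_compat; try apply Cmod_ge_0; [apply Rmult_le_pos; apply Cmod_ge_0| |exact H2].
    apply Rmult_le_compat_l; [apply Cmod_ge_0|exact HP2]. }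
  assert (HQ1 : (0 <= Q1 * Cmod y ^ N)%R)
    by (apply Rmult_le_pos; [apply Rlt_le, exp_pos|apply pow_le, Cmod_ge_0]).
  assert (HQ2 : (0 <= Q2 * Cmod y ^ N)%R)
    by (apply Rmult_le_pos; [apply Rlt_le, exp_pos|apply pow_le, Cmod_ge_0]).
  eapply Rle_trans; [apply Cmod_triangle|].
  assert (HC1 := Rmult_le_pos _ _ HM1 HQ2); assert (HC2 := Rmult_le_pos _ _ HM2 HQ1).
  lra.
Qed.
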